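(* Let $P_1,\dots,P_N\in\mathbb C[z_1,\dots,z_d]$ be nonzero polynomials, and let $\delta_1,\dots,\delta_N>0$ and $R>0$ be real numbers such that \[ \sum_{j=1}^N \delta_j^2\deg P_j\le R^2 . \] Then any point at which the function \[ z\mapsto e^{-|z|^2/2}\,|P_1(z)|^{\delta_1^2}\cdots|P_N(z)|^{\delta_N^2} \] attains its maximum over the ball $B^{2d}(R)\subset\mathbb C^d$ is, for every $k=1,\dots,N$, at Euclidean distance (in $\mathbb C^d$) at least $\delta_k$ from the zero set of $P_k$ in $\mathbb C^d$.
   Context: $B^{2d}(R)=\{z\in\mathbb C^d : |z|\le R\}$ is the closed ball of radius $R>0$ centered at the origin, where $|z|^2=|z_1|^2+\dots+|z_d|^2$. $\deg P$ is the total degree. The distance from a point to a set is the infimum of distances to its points; the distance to the empty set is $+\infty$. *)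

(* Defs.v *)
From HB Require Import structures.
From mathcomp Require Import all_boot all_order all_algebra.
From mathcomp Require Import complex.
From mathcomp Require Import classical_sets reals ereal sequences exp.
(* The notations of [mpoly] clash with those of MathComp-Analysis. *)
From mathcomp Require mpoly.
Import -(notations) mpoly.

Set Implicit Arguments.
Unset Strict Implicit.
Unset Printing Implicit Defensive.

Import Order.TTheory GRing.Theory Num.Theory.
Local Open Scope classical_set_scope.
Local Open Scope ring_scope.
Local Open Scope complex_scope.

(* [Normc.normc] is the modulus as an element of [R]; [`|x|] on [R[i]]
   has values in [R[i]], and [`|z|] on row vectors is the sup norm. *)
Definition l2norm (R : realType) (d : nat) (z : 'rV[R[i]]_d) : R :=
  Num.sqrt (\sum_(i < d) Normc.normc (z 0 i) ^+ 2).

Definition l2cball {R : realType} {d : nat} (r : R) : set 'rV[R[i]]_d :=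
  [set z | l2norm z <= r].

(* An infimum in [\bar R], so that the distance to [set0] is [+oo]. *)
Definition dist_to_set (R : realType) (d : nat) (z : 'rV[R[i]]_d)
    (A : set 'rV[R[i]]_d) : \bar R :=
  ereal_inf [set (l2norm (z - w))%:E | w in A].

Notation cpoly R d := (mpoly d R[i]).

Definition peval (R : realType) (d : nat) (P : cpoly R d) (z : 'rV[R[i]]_d)
    : R[i] :=
  meval (fun i => z 0 i) P.

(* [mmeasure mdeg], alias [msize], is one more than the total degree of a nonzero polynomial. *)
Definition tdeg (R : realType) (d : nat) (P : cpoly R d) : nat :=
  (mmeasure mdeg P).-1.

Definition zero_set (R : realType) (d : nat) (P : cpoly R d)
    : set 'rV[R[i]]_d :=
  [set z | peval P z = 0].

Definition weight (R : realType) (d N : nat) (P : 'I_N -> cpoly R d)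
    (delta : 'I_N -> R) (z : 'rV[R[i]]_d) : R :=
  expR (- (l2norm z ^+ 2 / 2)) *
  \prod_(j < N) Normc.normc (peval (P j) z) `^ (delta j ^+ 2).

Definition max_point_on (R : realType) (T : Type) (f : T -> R) (A : set T)
    (z : T) : Prop :=
  A z /\ forall w, A w -> f w <= f z.

(* Main.v *)
(* On a complex line, [e^(-|z|^2/2)] is [e^(-r^2/2)] times the exponential of a
   harmonic function, where [r] is the distance to a chosen center, and
   [r^n e^(-r^2/2)] increases for [r <= sqrt n] and decreases afterwards.
   On a line through the origin, [r^-n prod_j |P_j|^(delta_j^2)] with
   [n = sum_j delta_j^2 deg P_j] satisfies the maximum principle near infinity;
   hence a maximum over the ball is a maximum over all of [C^d].  If [P_k]
   vanishes at [w], then on the line through [w] and the maximum point [z] the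
   maximum principle for [r^(-delta_k^2) prod_j |P_j|^(delta_j^2)] shows that the
   weight exceeds its value at [z] somewhere on the circle of radius [delta_k]
   about [w], unless [|z - w| >= delta_k].
   The maximum principle for [e^(Re (b t)) prod_j |Q_j t|^(a_j)] comes from
   Cauchy's estimate [|T t0| <= S / (1 - |t0| / r)] for polynomials, where [S]
   bounds [|T|] on the circle of radius [r], applied to the polynomials
   [prod_j Q_j^(floor (p a_j) + 1) * (1 + b (t - t0) / p)^(p^2)] as [p] grows
   (with [Q_j t0 = 1]). *)
Require Import Defs.
From mathcomp Require Import all_boot all_order all_algebra.
From mathcomp Require Import complex.
From mathcomp Require Import classical_sets reals ereal sequences exp.
From mathcomp Require mpoly.
Import -(notations) mpoly.
From mathcomp Require Import cyclic separable cyclotomic topology normedtype.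
From mathcomp Require Import zify ring lra.

Import Order.TTheory GRing.Theory Num.Theory.
Local Open Scope classical_set_scope.
Local Open Scope ring_scope.

Set Implicit Arguments.
Unset Strict Implicit.
Unset Printing Implicit Defensive.

Import Normc numFieldNormedType.Exports.
Local Open Scope complex_scope.

(** * Roots of unity and Cauchy's estimate for polynomials *)

Lemma prim_root_exists (C : numClosedFieldType) (n : nat) :
  (0 < n)%N -> exists w : C, n.-primitive_root w.
Proof.
move=> n_gt0; have [rs] := closed_field_poly_normal ('X^n - 1 : {poly C}).
rewrite (monicP (monicXnsubC 1 n_gt0)) scale1r => rsE.
have /hasP[w _ w_prim] : has n.-primitive_root rs; last by exists w.
apply: has_prim_root => //.
- by apply/allP => x; rewrite /root_of_unity rsE root_prod_XsubC.
- rewrite -separable_prod_XsubC -rsE separable_Xn_sub_1 //.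
  by rewrite pnatr_eq0 -lt0n.
- by rewrite -ltnS -(size_prod_XsubC rs id) -rsE size_XnsubC.
Qed.

Lemma sum_prim_root_expr (C : fieldType) (n e : nat) (w : C) :
  n.-primitive_root w ->
  \sum_(k < n) w ^+ (e * k) = if (n %| e)%N then n%:R else 0.
Proof.
move=> w_prim; have n_gt0 := prim_order_gt0 w_prim.
under eq_bigr do rewrite exprM.
case: ifPn => [n_dvd|n_ndvd].
  have /eqP -> : w ^+ e == 1 by rewrite -(prim_order_dvd w_prim).
  under eq_bigr do rewrite expr1n.
  by rewrite sumr_const card_ord.
have we_neq1 : w ^+ e - 1 != 0 by rewrite subr_eq0 -(prim_order_dvd w_prim).
apply: (mulfI we_neq1); rewrite -subrX1 mulr0.
by rewrite exprAC (prim_expr_order w_prim) expr1n subrr.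
Qed.

(* Average over the vertices of a regular polygon with more than [deg T] vertices. *)
Lemma cauchy_estimate (C : numClosedFieldType) (T : {poly C}) (r S : C) :
  0 < r -> (forall t, `|t| = r -> `|T.[t]| <= S) ->
  forall l : nat, `|T`_l| * r ^+ l <= S.
Proof.
(* As [n] is above [l] and at least [size T], no index of [T] other than [l] is congruent to [l]
   modulo [n]. *)
move=> r_gt0 T_le l; pose n := maxn (size T) l.+1.
have n_gt0 : (0 < n)%N by rewrite (leq_trans _ (leq_maxr _ _)).
have l_lt_n : (l < n)%N by rewrite leq_maxr.
have [w w_prim] := prim_root_exists C n_gt0.
have w_norm k : `|w ^+ k| = 1.
  rewrite normrX; suff -> : `|w| = 1 by rewrite expr1n.
  apply/eqP; rewrite -(@pexpr_eq1 _ _ n) ?normr_ge0 //.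
  by rewrite -normrX (prim_expr_order w_prim) normr1.
(* A discrete Fourier transform; the exponent [n - l] stands for [-l], as [w ^+ n = 1]. *)
have avg : \sum_(k < n) T.[r * w ^+ k] * w ^+ ((n - l) * k) =
           n%:R * (T`_l * r ^+ l).
  under eq_bigr => k _ do rewrite (@horner_coef_wide _ n) ?leq_maxl // mulr_suml.
  rewrite exchange_big /=.
  under eq_bigr => i _.
    under eq_bigr => k _.
      rewrite exprMn mulrA -exprM mulnC -mulrA -exprD -mulnDl.
      over.
    rewrite -mulr_sumr (sum_prim_root_expr _ w_prim).
    over.
  rewrite (bigD1 (Ordinal l_lt_n)) //= subnKC ?dvdnn ?(ltnW l_lt_n) //.
  rewrite big1 ?addr0 => [|i i_neq]; first by rewrite mulrC.
  case: ifP; last by rewrite mulr0.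
  have {i_neq} i_neq : (i != l :> nat)%N by [].
  move=> /dvdnP[q e]; exfalso; move: e i_neq (ltn_ord i) l_lt_n.
  by case: q => [|[|q]]; lia.
have n_gt0' : 0 < n%:R :> C by rewrite ltr0n.
rewrite -(ler_pM2l n_gt0').
have -> : `|T`_l| * r ^+ l = `|T`_l * r ^+ l|.
  by rewrite normrM normrX (gtr0_norm r_gt0).
rewrite -[leLHS]ger0_norm ?mulr_ge0 ?ler0n // normrM normr_id -normrM -avg.
apply: le_trans (ler_norm_sum _ _ _) _.
apply: (@le_trans _ _ (\sum_(k < n) S)); last first.
  by rewrite sumr_const card_ord mulr_natl lexx.
apply: ler_sum => k _; rewrite normrM w_norm mulr1 T_le //.
by rewrite normrM w_norm mulr1 gtr0_norm.
Qed.

(** Cauchy's estimate bounds the terms by a geometric series of ratio [|t0| / r]. The factor lost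
    does not depend on [T], so high powers make it harmless. *)
Lemma norm_horner_interior (C : numClosedFieldType) (T : {poly C})
    (t0 r S : C) :
  `|t0| < r -> (forall t, `|t| = r -> `|T.[t]| <= S) ->
  `|T.[t0]| <= S / (1 - `|t0| / r).
Proof.
move=> t0_lt T_le; have r_gt0 : 0 < r by exact: le_lt_trans t0_lt.
set x := `|t0| / r.
have x_lt1 : x < 1 by rewrite ltr_pdivrMr ?mul1r.
have x_ge0 : 0 <= x by rewrite divr_ge0 // ltW.
have S_ge0 : 0 <= S.
  by rewrite (le_trans (normr_ge0 _) (T_le r _)) ?gtr0_norm.
rewrite ler_pdivlMr ?subr_gt0 //.
apply: (@le_trans _ _ ((\sum_(i < size T) S * x ^+ i) * (1 - x))).
  apply: ler_wpM2r; first by rewrite subr_ge0 ltW.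
  rewrite horner_coef (le_trans (ler_norm_sum _ _ _)) //.
  apply: ler_sum => i _; rewrite normrM normrX.
  rewrite -[`|t0|](@divfK _ r) ?gt_eqF // -/x exprMn mulrCA mulrC.
  by rewrite ler_wpM2r ?exprn_ge0 // cauchy_estimate.
rewrite -mulr_sumr -mulrA ler_piMr //.
have -> : (\sum_(i < size T) x ^+ i) * (1 - x) = 1 - x ^+ size T.
  by rewrite -[1 - x ^+ _]opprB subrX1 -[1 - x]opprB mulrN mulrC.
by rewrite gerBl exprn_ge0.
Qed.

(** * Moduli of complex numbers and of polynomial values *)

Lemma normcE (K : rcfType) (x : K[i]) : `|x| = (normc x)%:C.
Proof. by []. Qed.

Lemma normc_ge0 (K : rcfType) (x : K[i]) : 0 <= normc x.
Proof. by rewrite -lecR -normcE normr_ge0. Qed.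

Lemma normc_real (K : rcfType) (x : K) : normc x%:C = `|x|.
Proof. by rewrite /= expr0n addr0 sqrtr_sqr. Qed.

Lemma normcX (K : rcfType) (x : K[i]) n : normc (x ^+ n) = normc x ^+ n.
Proof. by elim: n => [|n IHn]; rewrite ?normc1 // !exprS normcM IHn. Qed.

Lemma normc_prod (K : rcfType) (I : finType) (F : I -> K[i]) :
  normc (\prod_i F i) = \prod_i normc (F i).
Proof.
by apply: (big_morph (@normc K)) => [x y|]; rewrite ?normcM ?normc1.
Qed.

Lemma normc_eq0 (K : rcfType) (x : K[i]) : (normc x == 0) = (x == 0).
Proof.
by apply/eqP/eqP => [/eq0_normc //|->]; rewrite normc0.
Qed.

Lemma normc_gt0 (K : rcfType) (x : K[i]) : (0 < normc x) = (x != 0).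
Proof. by rewrite lt_def normc_ge0 andbT normc_eq0. Qed.

Lemma normcD_sqr (K : rcfType) (x y : K[i]) :
  normc (x + y) ^+ 2 =
  normc x ^+ 2 + normc y ^+ 2 + 2 * complex.Re (x^*%C * y).
Proof.
case: x y => [a b] [c e] /=.
rewrite !sqr_sqrtr ?addr_ge0 ?sqr_ge0 //; ring.
Qed.

Lemma normc_horner_interior (K : rcfType) (T : {poly K[i]})
    (t0 : K[i]) (r S : K) :
  normc t0 < r -> (forall t, normc t = r -> normc T.[t] <= S) ->
  normc T.[t0] <= S / (1 - normc t0 / r).
Proof.
move=> t0_lt T_le; rewrite -lecR -normcE.
have -> : (S / (1 - normc t0 / r))%:C = S%:C / (1 - `|t0| / r%:C).
  by rewrite normcE !(rmorphM, fmorphV, rmorphB, rmorph1).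
apply: norm_horner_interior; first by rewrite normcE ltcR.
by move=> t; rewrite !normcE lecR => /complexI /T_le.
Qed.

(** With [1 <= M], the bound also absorbs the factor [Num.max 1 x] of [exprn_round_powR]. *)
Lemma normc_horner_bound (K : rcfType) (T : {poly K[i]}) (r : K) :
  exists2 M : K, 1 <= M & forall t, normc t = r -> normc T.[t] <= M.
Proof.
exists (1 + \sum_(i < size T) normc T`_i * `|r| ^+ i).
  by rewrite lerDl sumr_ge0 // => i _; rewrite mulr_ge0 ?normc_ge0 ?exprn_ge0.
move=> t t_r; rewrite -lecR -normcE horner_coef.
rewrite (le_trans (ler_norm_sum _ _ _)) //.
under eq_bigr do rewrite normrM normrX !normcE t_r -rmorphXn -rmorphM.
rewrite -rmorph_sum lecR -t_r ger0_norm ?normc_ge0 //.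
by rewrite lerDr.
Qed.

(** * Maximum principle for products of real powers of polynomials *)

Lemma exists_geometric_lt1 (K : realType) (A q : K) :
  0 <= q < 1 -> exists2 p : nat, (0 < p)%N & A * q ^+ p < 1.
Proof.
move=> /andP[q_ge0 q_lt1].
have /cvgr_lt /(_ 1 ltr01) [p _ p_lt] : (fun n => A * q ^+ n) @ \oo --> (0 : K).
  by apply: cvg_geometric; rewrite ger0_norm.
by exists p.+1 => //; apply: p_lt => /=.
Qed.

(* Rounding the exponent [p * a] up to an integer costs at most one factor. *)
Lemma exprn_round_powR (K : realType) (x a : K) (p : nat) :
  0 <= x -> 0 <= a ->
  x ^+ (Num.truncn (p%:R * a)).+1 <= (x `^ a) ^+ p * Num.max 1 x.
Proof.
move=> x_ge0 a_ge0; have pa_ge0 : 0 <= p%:R * a by rewrite mulr_ge0.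
have /andP[le_pa pa_lt] := truncn_itv pa_ge0.
rewrite -powR_mulrn // -[X in _ <= X * _]powR_mulrn ?powR_ge0 // -powRrM mulrC.
rewrite [a * _]mulrC.
have [->|x_neq0] := eqVneq x 0.
  by rewrite powR0 ?pnatr_eq0 // mulr_ge0 ?powR_ge0 // le_max ler01.
have x_gt0 : 0 < x by rewrite lt_def x_neq0.
have [x_le1|x_gt1] := leP x 1.
  by rewrite mulr1 ger_powR ?x_gt0 // ltW.
rewrite -[X in _ <= _ * X](@powRr1 _ x) // -powRD ?x_neq0 ?implybT //.
by rewrite ler_powR ?(ltW x_gt1) // -natr1 lerD2r.
Qed.

(** Squared, this is [1 + y <= expR y] at [y = 2 Re x + |x|^2]. *)
Lemma normc_1D_le (K : realType) (x : K[i]) :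
  normc (1 + x) <= expR (complex.Re x + normc x ^+ 2 / 2).
Proof.
rewrite -(@ler_pXn2r _ 2) ?nnegrE ?normc_ge0 ?expR_ge0 //.
rewrite normcD_sqr -expRM_natl normc1.
have -> : complex.Re (1^*%C * x) = complex.Re x by rewrite rmorph1 mul1r.
apply: le_trans (expR_ge1Dx _).
by rewrite le_eqVlt; apply/orP; left; apply/eqP; field.
Qed.

(** Each of the [p * p] factors has a quadratic error [|u / p|^2 / 2] in the exponent; their sum
    does not depend on [p]. *)
Lemma expr_1D_div_le (K : realType) (u : K[i]) (p : nat) : (0 < p)%N ->
  normc (1 + (p%:R^-1)%:C * u) ^+ (p * p) <=
  expR (complex.Re u) ^+ p * expR (normc u ^+ 2 / 2).
Proof.
move=> p_gt0; have p_neq0 : p%:R != 0 :> K by rewrite pnatr_eq0 -lt0n.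
apply: (@le_trans _ _ (expR (complex.Re ((p%:R^-1)%:C * u) +
    normc ((p%:R^-1)%:C * u) ^+ 2 / 2) ^+ (p * p))).
  by rewrite lerXn2r ?nnegrE ?normc_ge0 ?expR_ge0 ?normc_1D_le.
rewrite -!expRM_natl -expRD ler_expR normcM normc_real.
rewrite ger0_norm ?invr_ge0 ?ler0n //.
have -> : complex.Re ((p%:R^-1)%:C * u) = p%:R^-1 * complex.Re u.
  by case: u => a b /=; rewrite mul0r subr0.
by rewrite natrM le_eqVlt; apply/orP; left; apply/eqP; field.
Qed.

(** If [B < 1], the polynomial [T] replacing the [p]-th power of the function is 1 at [t0] but at
    most a constant times [B ^+ p] on the circle, against the interior estimate for large [p]. *)
Lemma max_principle_normalized (K : realType) (N : nat)
    (Q : 'I_N -> {poly K[i]}) (a : 'I_N -> K) (b t0 : K[i]) (r B : K) :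
  normc t0 < r -> (forall j, 0 <= a j) -> (forall j, (Q j).[t0] = 1) ->
  (forall t, normc t = r ->
    expR (complex.Re (b * (t - t0))) * \prod_j normc (Q j).[t] `^ a j <= B) ->
  1 <= B.
Proof.
move=> t0_lt a_ge0 Q1 le_B; rewrite leNgt; apply/negP => B_lt1.
have r_gt0 : 0 < r by exact: le_lt_trans (normc_ge0 _) t0_lt.
have normc_r : normc r%:C = r by rewrite normc_real gtr0_norm.
have B_ge0 : 0 <= B.
  apply: le_trans (le_B _ normc_r).
  by rewrite mulr_ge0 ?expR_ge0 ?prodr_ge0 // => j _; exact: powR_ge0.
have [M M_ge1 Q_le] := fin_all_exists2 (fun j => normc_horner_bound (Q j) r).
pose E := expR ((normc b * (r + normc t0)) ^+ 2 / 2).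
pose A := (\prod_j M j) * E / (1 - normc t0 / r).
have [|p p_gt0] := @exists_geometric_lt1 K A B; first by rewrite B_ge0.
apply/negP; rewrite -leNgt.
pose e j := (Num.truncn (p%:R * a j)).+1.
pose L : {poly K[i]} := 1 + ((p%:R^-1)%:C * b) *: ('X - t0%:P).
pose T := (\prod_j Q j ^+ e j) * L ^+ (p * p).
have LE t : L.[t] = 1 + (p%:R^-1)%:C * (b * (t - t0)).
  by rewrite /L hornerD hornerZ hornerXsubC -polyC1 hornerC mulrA.
have <- : normc T.[t0] = 1.
  rewrite hornerM horner_exp LE subrr !mulr0 addr0 expr1n mulr1 horner_prod.
  by rewrite big1 ?normc1 // => j _; rewrite horner_exp Q1 expr1n.
have -> : A * B ^+ p = ((\prod_j M j) * E * B ^+ p) / (1 - normc t0 / r).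
  by rewrite /A mulrAC.
apply: normc_horner_interior => // t t_r.
rewrite hornerM horner_exp LE horner_prod normcM normcX normc_prod.
under eq_bigr do rewrite horner_exp normcX.
have le_prod : \prod_j normc (Q j).[t] ^+ e j <=
    (\prod_j normc (Q j).[t] `^ a j) ^+ p * \prod_j M j.
  rewrite -prodrXl -big_split; apply: ler_prod => j _.
  rewrite exprn_ge0 ?normc_ge0 //=.
  rewrite (le_trans (exprn_round_powR _ (normc_ge0 _) (a_ge0 j))) //.
  by rewrite ler_wpM2l ?exprn_ge0 ?powR_ge0 // ge_max M_ge1 Q_le.
have le_L : normc (1 + (p%:R^-1)%:C * (b * (t - t0))) ^+ (p * p) <=
    expR (complex.Re (b * (t - t0))) ^+ p * E.
  apply: le_trans (expr_1D_div_le _ p_gt0) _.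
  rewrite ler_wpM2l ?exprn_ge0 ?expR_ge0 // ler_expR ler_wpM2r ?invr_ge0 ?ler0n //.
  rewrite lerXn2r ?nnegrE ?mulr_ge0 ?addr_ge0 ?normc_ge0 ?(ltW r_gt0) //.
  rewrite normcM ler_wpM2l ?normc_ge0 // -t_r.
  by rewrite -[normc t0]normcN le_normcD.
apply: le_trans (ler_pM _ _ le_prod le_L) _.
- by rewrite prodr_ge0 // => j _; rewrite exprn_ge0 ?normc_ge0.
- by rewrite exprn_ge0 ?normc_ge0.
have M_ge0 : 0 <= \prod_j M j.
  by rewrite prodr_ge0 // => j _; rewrite (le_trans ler01).
rewrite [leLHS](_ : _ = (\prod_j M j) * E * (expR (complex.Re (b * (t - t0))) *
  \prod_j normc (Q j).[t] `^ a j) ^+ p); last by rewrite exprMn; ring.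
apply: ler_wpM2l; first by rewrite mulr_ge0 ?expR_ge0.
rewrite lerXn2r ?nnegrE ?le_B ?mulr_ge0 ?expR_ge0 ?prodr_ge0 // => j _.
exact: powR_ge0.
Qed.

(* [e^(Re (b t))] and [|Q j|^(a j)] have subharmonic logarithms. *)
Lemma max_principle (K : realType) (N : nat)
    (Q : 'I_N -> {poly K[i]}) (a : 'I_N -> K) (b t0 : K[i]) (r B : K) :
  normc t0 < r -> (forall j, 0 < a j) ->
  (forall t, normc t = r ->
    expR (complex.Re (b * t)) * \prod_j normc (Q j).[t] `^ a j <= B) ->
  expR (complex.Re (b * t0)) * \prod_j normc (Q j).[t0] `^ a j <= B.
Proof.
move=> t0_lt a_gt0 le_B.
have r_gt0 : 0 < r by exact: le_lt_trans (normc_ge0 _) t0_lt.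
have normc_r : normc r%:C = r by rewrite normc_real gtr0_norm.
(* A vanishing factor makes the left side 0, because [powR 0 a = 0] for [a > 0]. *)
have [/existsP[j /eqP Qj0]|] := boolP [exists j, (Q j).[t0] == 0].
  rewrite (bigD1 j) //= Qj0 normc0 powR0 ?gt_eqF // mul0r mulr0.
  apply: le_trans (le_B _ normc_r).
  by rewrite mulr_ge0 ?expR_ge0 ?prodr_ge0 // => i _; exact: powR_ge0.
rewrite negb_exists => /forallP Q_neq0; set V := expR _ * _.
have V_gt0 : 0 < V.
  rewrite mulr_gt0 ?expR_gt0 ?prodr_gt0 // => j _.
  by rewrite powR_gt0 ?normc_gt0.
rewrite -[V]mul1r -ler_pdivlMr //.
apply: (@max_principle_normalized _ _ (fun j => (Q j).[t0]^-1 *: Q j) a b t0 r)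
  => // [j|j|t t_r]; first exact: ltW.
  by rewrite hornerZ mulVf.
rewrite ler_pdivlMr // (le_trans _ (le_B t t_r)) // /V mulrACA -expRD -raddfD.
rewrite -mulrDr subrK -big_split /= ler_wpM2l ?expR_ge0 //.
rewrite le_eqVlt; apply/orP; left; apply/eqP/eq_bigr => j _.
by rewrite -powRM ?normc_ge0 // -normcM hornerZ mulrAC mulVf ?mul1r.
Qed.

(** * Points where a nonzero polynomial does not vanish *)

Lemma exists_nonroot (C : numDomainType) (p : {poly C}) :
  p != 0 -> exists x, p.[x] != 0.
Proof.
move=> p_neq0; pose rs : seq C := [seq i%:R | i <- iota 0 (size p)].
have [/allPn[x _ px]|/negPn all_roots] := boolP (~~ all (root p) rs).
  by exists x.
have := max_poly_roots p_neq0 all_roots.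
by rewrite map_inj_uniq ?iota_uniq ?size_map ?size_iota ?ltnn => [/(_ isT)|];
  last exact: mulrIn (oner_neq0 _).
Qed.

(** A monomial of [p] is determined by its last exponent and its truncation to the other variables,
    so no terms merge in [muni p]. *)
Lemma muni_eq0 (R : nzRingType) (n : nat) (p : mpoly n.+1 R) :
  (muni p == 0) = (p == 0).
Proof.
apply/idP/idP => [|/eqP ->]; last by rewrite muni0.
apply: contraTT => p_neq0.
have [m m_in] : exists m, m \in msupp p.
  case E : (msupp p) => [|m s]; last by exists m; rewrite mem_head.
  by move/eqP: E; rewrite msupp_eq0 (negPf p_neq0).
apply/eqP => /(congr1 (fun q : {poly mpoly n R} => mcoeff
  (Multinom [tuple m (widen_ord (leqnSn n) i) | i < n]) q`_(m ord_max))).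
rewrite muniE coef_sum coef0 mcoeff0 raddf_sum (bigD1_seq m) //=.
rewrite big1_seq => [|m' /andP[m'_neq _]].
  rewrite addr0 coefZ coefXn eqxx mulr1 mcoeffZ mcoeffX eqxx mulr1 => /eqP.
  by rewrite mcoeff_eq0 m_in.
rewrite coefZ coefXn; case: eqP => [e_max|]; last by rewrite mulr0 mcoeff0.
rewrite mulr1 mcoeffZ mcoeffX; case: eqP => [/mnmP e|]; last by rewrite mulr0.
case/eqP: m'_neq; apply/mnmP => i; have [j ->|->] := unliftP ord_max i.
  have -> : lift ord_max j = widen_ord (leqnSn n) j.
    by apply: val_inj; rewrite /= /bump leqNgt ltn_ord.
  by have := e j; rewrite !mnmE.
by [].
Qed.

(** By induction, the first [n] coordinates avoid the zeros of the leading coefficient in the last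
    variable, which then avoids finitely many roots. *)
Lemma exists_meval_neq0 (C : numDomainType) (n : nat) (p : mpoly n C) :
  p != 0 -> exists v, meval v p != 0.
Proof.
elim: n p => [|n IHn] p p_neq0.
  by exists (fun=> 0); move: p_neq0; rewrite (nvar0_mpolyC p) mevalC mpolyC_eq0.
pose u := muni p; have : lead_coef u != 0 by rewrite lead_coef_eq0 muni_eq0.
case/IHn => v uv_neq0; have : map_poly (meval v) u != 0.
  by rewrite -lead_coef_eq0 lead_coef_map_eq.
case/exists_nonroot => x ux_neq0.
(* [insub] fails exactly at the last index, which receives [x]. *)
exists (fun i : 'I_n.+1 => oapp v x (insub (i : nat))).
suff -> : meval (fun i : 'I_n.+1 => oapp v x (insub (i : nat))) p =
  (map_poly (meval v) u).[x] by [].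
rewrite mevalE /u muniE rmorph_sum horner_sum /=; apply: eq_bigr => m _.
rewrite map_polyZ map_polyXn hornerZ hornerXn /= mevalZ mevalX -mulrA.
congr (_ * _); rewrite big_ord_recr /= insubF ?ltnn //=; congr (_ * _).
by apply: eq_bigr => i _; rewrite mnmE valK.
Qed.

(** * Euclidean norm and polynomials on complex lines *)

Lemma l2norm_ge0 (K : realType) d (z : 'rV[K[i]]_d) : 0 <= l2norm z.
Proof. exact: sqrtr_ge0. Qed.

Lemma sqr_l2norm (K : realType) d (z : 'rV[K[i]]_d) :
  l2norm z ^+ 2 = \sum_(i < d) normc (z 0 i) ^+ 2.
Proof. by rewrite sqr_sqrtr // sumr_ge0 // => i _; rewrite sqr_ge0. Qed.

Lemma l2norm_eq0 (K : realType) d (z : 'rV[K[i]]_d) :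
  l2norm z = 0 -> z = 0.
Proof.
move/(congr1 (fun x => x ^+ 2)); rewrite sqr_l2norm expr0n /= => /eqP.
rewrite psumr_eq0 => [/allP z0|i _]; last exact: sqr_ge0.
apply/rowP => i; apply/eqP; rewrite mxE -normc_eq0 -sqrf_eq0.
by apply: z0; rewrite mem_index_enum.
Qed.

Lemma l2normZ (K : realType) d (c : K[i]) (z : 'rV[K[i]]_d) :
  l2norm (c *: z) = normc c * l2norm z.
Proof.
apply/eqP; rewrite -(@eqrXn2 _ 2) ?mulr_ge0 ?l2norm_ge0 ?normc_ge0 //.
rewrite exprMn !sqr_l2norm mulr_sumr; apply/eqP/eq_bigr => i _.
by rewrite mxE normcM exprMn.
Qed.

(** The cross term is the real part of a linear function of [t]: the harmonic part of the Gaussian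
    exponent. *)
Lemma sqr_l2norm_line (K : realType) d (w v : 'rV[K[i]]_d) (t : K[i]) :
  l2norm (w + t *: v) ^+ 2 = l2norm w ^+ 2 + normc t ^+ 2 * l2norm v ^+ 2 +
    2 * complex.Re ((\sum_(i < d) (w 0 i)^*%C * v 0 i) * t).
Proof.
rewrite -exprMn -l2normZ !sqr_l2norm mulr_suml raddf_sum mulr_sumr -!big_split.
apply: eq_bigr => i _ /=; rewrite !mxE normcD_sqr.
by rewrite -mulrA [v 0 i * t]mulrC.
Qed.

Definition line_poly (R : comNzRingType) d (P : mpoly d R) (w v : 'rV[R]_d) :
    {poly R} :=
  mmap polyC (fun i => (w 0 i)%:P + v 0 i *: 'X) P.

Lemma horner_line_poly (K : realType) d (P : cpoly K d) (w v : 'rV[K[i]]_d)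
    (t : K[i]) :
  (line_poly P w v).[t] = peval P (w + t *: v).
Proof.
rewrite /peval mevalE /line_poly /mmap horner_sum; apply: eq_bigr => m _.
rewrite hornerM hornerC /mmap1 horner_prod; congr (_ * _).
apply: eq_bigr => i _.
by rewrite horner_exp hornerD hornerC hornerZ hornerX !mxE mulrC.
Qed.

(** [P] on the line through 0 and [v] in the coordinate [s = 1 / t] at infinity, times [s ^+ tdeg P]
    to clear the pole. *)
Definition rev_line_poly (K : realType) d (P : cpoly K d) (v : 'rV[K[i]]_d) :
    {poly K[i]} :=
  \sum_(m <- msupp P)
    (mcoeff m P * \prod_(i < d) v 0 i ^+ m i) *: 'X^(tdeg P - mdeg m).

Lemma horner_rev_line_poly (K : realType) d (P : cpoly K d)
    (v : 'rV[K[i]]_d) (s : K[i]) :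
  s != 0 -> (rev_line_poly P v).[s] = s ^+ tdeg P * peval P (s^-1 *: v).
Proof.
move=> s_neq0; rewrite /peval mevalE horner_sum mulr_sumr.
apply: eq_big_seq => m m_in.
have m_le : (mdeg m <= tdeg P)%N.
  by have := mmeasure_mnm_lt mdeg m_in; rewrite /tdeg; case: mmeasure.
rewrite hornerZ hornerXn mulrC mulrCA [RHS]mulrCA; congr (_ * _).
under [in RHS]eq_bigr do rewrite mxE exprMn.
rewrite big_split /= mulrA; congr (_ * _).
rewrite -(big_morph _ (fun x y => exprD _ x y) (expr0 _)) -mdegE exprVn.
by rewrite -{2}(subnK m_le) exprD mulfK ?expf_neq0.
Qed.

(** * Maximum points of the weight *)

Lemma weight_ge0 (K : realType) d N (P : 'I_N -> cpoly K d) delta z :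
  0 <= weight P delta z.
Proof.
by rewrite mulr_ge0 ?expR_ge0 ?prodr_ge0 // => j _; exact: powR_ge0.
Qed.

(** For [y] outside the ball, [s |-> y / s] maps the circle of radius [rho] into the sphere of
    radius [R], and 1 to [y]. The maximum principle in [s] costs a factor [rho^n], which the
    Gaussian outweighs. *)
Lemma weight_max_global (K : realType) (d N : nat) (P : 'I_N -> cpoly K d)
    (delta : 'I_N -> K) (R : K) (z y : 'rV[K[i]]_d) :
  (forall j, 0 < delta j) -> 0 < R ->
  \sum_(j < N) delta j ^+ 2 * (tdeg (P j))%:R <= R ^+ 2 ->
  max_point_on (weight P delta) (l2cball R) z ->
  weight P delta y <= weight P delta z.
Proof.
move=> delta_gt0 R_gt0 sum_le [_ z_max].
have [y_le|y_gt] := leP (l2norm y) R; first exact: z_max.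
pose n := \sum_(j < N) delta j ^+ 2 * (tdeg (P j))%:R.
have [rho rho_gt1 yE] : exists2 rho, 1 < rho & l2norm y = rho * R.
  by exists (l2norm y / R); rewrite ?divfK ?gt_eqF // ltr_pdivlMr ?mul1r.
have rho_gt0 : 0 < rho by exact: lt_trans rho_gt1.
have rhoE : rho = expR (ln rho) by rewrite lnK.
have lnrho_ge0 : 0 <= ln rho by rewrite ln_ge0 // ltW.
pose B := expR (n * ln rho) * expR (R ^+ 2 / 2) * weight P delta z.
have : expR (complex.Re (0 * 1)) *
    \prod_j normc (rev_line_poly (P j) y).[1] `^ (delta j ^+ 2) <= B.
  apply: (@max_principle _ _ (fun j => rev_line_poly (P j) y)
    (fun j => delta j ^+ 2) 0 1 rho) => [|j|s s_rho].
  - by rewrite normc1.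
  - by rewrite exprn_gt0.
  have s_neq0 : s != 0 by rewrite -normc_gt0 s_rho.
  rewrite mul0r expR0 mul1r.
  under eq_bigr => j _.
    rewrite horner_rev_line_poly // normcM normcX s_rho.
    rewrite powRM ?exprn_ge0 ?normc_ge0 ?(ltW rho_gt0) //.
    rewrite [rho in rho ^+ _]rhoE -expRM_natl -expRM.
    rewrite (_ : _ * ln rho * _ =
      delta j ^+ 2 * (tdeg (P j))%:R * ln rho); last by ring.
    over.
  rewrite big_split /= -expR_sum -mulr_suml -/n /B -mulrA.
  have sy : l2norm (s^-1 *: y) = R.
    by rewrite l2normZ normcV s_rho yE mulKf ?gt_eqF.
  rewrite (_ : \prod_j _ = expR (R ^+ 2 / 2) * weight P delta (s^-1 *: y)).
    apply: ler_wpM2l; first exact: expR_ge0.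
    apply: ler_wpM2l; first exact: expR_ge0.
    by apply: z_max; rewrite /l2cball /= sy.
  by rewrite /weight sy mulrA -expRD subrr expR0 mul1r.
rewrite mul0r expR0 mul1r.
under eq_bigr do rewrite horner_rev_line_poly ?oner_neq0 // expr1n mul1r invr1 scale1r.
move=> /(ler_wpM2l (expR_ge0 (- (l2norm y ^+ 2 / 2)))) /le_trans -> //.
rewrite /B -expRD mulrA -expRD ler_piMl ?weight_ge0 // expR_le1.
(* As [n <= R^2], the exponent left is at most [R^2 (2 ln rho + 1 - rho^2) / 2]. *)
have n_le : n * ln rho <= R ^+ 2 * ln rho by rewrite ler_wpM2r.
have ln_le : 2 * ln rho <= rho ^+ 2 - 1.
  rewrite mulr_natl -lnXn // -[X in ln X](subrK 1) addrC le_ln1Dx //.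
  by rewrite ltrBrDr addNr exprn_gt0.
have rhoR : rho ^+ 2 * R ^+ 2 = l2norm y ^+ 2.
  by rewrite -exprMn -yE.
have := ler_wpM2l (ltW (exprn_gt0 2 R_gt0)) ln_le; lra.
Qed.

(** The product of the [P j] is nonzero. This makes the maximum of the weight positive. *)
Lemma exists_weight_gt0 (K : realType) d N (P : 'I_N -> cpoly K d) delta :
  (forall j, P j != 0) -> exists z, 0 < weight P delta z.
Proof.
move=> P_neq0; have [|v] := @exists_meval_neq0 _ _ (\prod_j P j).
  by apply/prodf_neq0.
rewrite rmorph_prod => /prodf_neq0 Pv_neq0.
exists (\row_i v i); rewrite mulr_gt0 ?expR_gt0 ?prodr_gt0 // => j _.
rewrite powR_gt0 // normc_gt0 /peval.
by rewrite (meval_eq (v2 := v)) ?Pv_neq0 // => i; rewrite mxE.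
Qed.

(* A disc centred at the zero [w] of [P k]: on it the weight is
   [r^(delta k^2) e^(-r^2/2)], which increases for [r < delta k], times the
   exponential of a subharmonic function. *)
Lemma weight_global_max_dist (K : realType) (d N : nat)
    (P : 'I_N -> cpoly K d) (delta : 'I_N -> K) (z w : 'rV[K[i]]_d) (k : 'I_N) :
  (forall j, 0 < delta j) -> 0 < weight P delta z ->
  (forall y, weight P delta y <= weight P delta z) ->
  peval (P k) w = 0 -> delta k <= l2norm (z - w).
Proof.
move=> delta_gt0 z_gt0 z_max Pkw; rewrite leNgt; apply/negP => zw_lt.
pose v := z - w; pose rho := l2norm v; pose a j := delta j ^+ 2.
have a_gt0 j : 0 < a j by rewrite exprn_gt0.
have zE : z = w + 1 *: v by rewrite scale1r addrC subrK.
(* The weight vanishes at [w] but not at [z]. *)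
have rho_gt0 : 0 < rho.
  rewrite lt_def l2norm_ge0 andbT; apply/eqP => /l2norm_eq0 /eqP.
  rewrite subr_eq0 => /eqP zw; move: z_gt0.
  rewrite /weight (bigD1 k) //= zw Pkw normc0 powR0 ?gt_eqF ?exprn_gt0 //.
  by rewrite mul0r mulr0 ltxx.
pose b := \sum_(i < d) (w 0 i)^*%C * v 0 i.
pose Q j := line_poly (P j) w v.
(* One factor [t] taken out of [Q k] yields the radial factor [|t|^(a k)]. *)
have /factor_theorem[q Qk] : root (Q k) 0.
  by rewrite rootE horner_line_poly scale0r addr0 Pkw.
pose Q' j := if j == k then q else Q j.
have weightE t : weight P delta (w + t *: v) =
    expR (- ((l2norm w ^+ 2 + normc t ^+ 2 * rho ^+ 2) / 2)) *
    normc t `^ a k *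
    (expR (complex.Re (- b * t)) * \prod_j normc (Q' j).[t] `^ a j).
  rewrite /weight sqr_l2norm_line -/b -/rho.
  have -> : \prod_j normc (peval (P j) (w + t *: v)) `^ (delta j ^+ 2) =
      normc t `^ a k * \prod_j normc (Q' j).[t] `^ a j.
    rewrite (bigD1 k) // [in RHS](bigD1 k) //= mulrA -horner_line_poly.
    rewrite -/(Q k) Qk hornerM hornerXsubC subr0 normcM powRM ?normc_ge0 //.
    rewrite /Q' eqxx [_ `^ a k * _]mulrC; congr (_ * _).
    by apply: eq_bigr => j /negPf ->; rewrite horner_line_poly.
  rewrite [RHS]mulrACA -expRD; congr (expR _ * _).
  by rewrite mulNr raddfN /=; field.
(* [|t| = expR lam] is the circle of radius [delta k] about [w], since [v] has norm [rho]; [t = 1]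
   gives [z]. *)
have [lam lam_gt0 deltaE] : exists2 lam, 0 < lam & delta k = expR lam * rho.
  exists (ln (delta k / rho)); first by rewrite ln_gt0 // ltr_pdivlMr ?mul1r.
  by rewrite lnK ?divfK ?gt_eqF // posrE divr_gt0.
(* The weight at [z] divided by the radial factor on that circle. *)
pose B := weight P delta z *
  expR ((l2norm w ^+ 2 + delta k ^+ 2) / 2 - a k * lam).
have X_le : expR (complex.Re (- b * 1)) * \prod_j normc (Q' j).[1] `^ a j <= B.
  apply: (@max_principle _ _ Q' a (- b) 1 (expR lam)) => // [|t t_r].
    by rewrite normc1 expR_gt1.
  rewrite -ler_pdivrMr ?expR_gt0 // -expRN.
  apply: le_trans (z_max (w + t *: v)); rewrite weightE t_r -expRM -expRD.
  rewrite deltaE exprMn mulrC.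
  by rewrite (_ : - (_ - a k * lam) =
    - ((l2norm w ^+ 2 + expR lam ^+ 2 * rho ^+ 2) / 2) + lam * a k) //; ring.
have : weight P delta z <= weight P delta z *
    expR ((delta k ^+ 2 - rho ^+ 2) / 2 - a k * lam).
  rewrite {1}zE weightE normc1 powR1 mulr1 expr1n mul1r.
  apply: le_trans (ler_wpM2l (expR_ge0 _) X_le) _.
  rewrite le_eqVlt; apply/orP; left; apply/eqP.
  by rewrite /B mulrCA -expRD; congr (_ * expR _); field.
rewrite ler_pMr // leNgt expR_lt1 -leNgt.
(* Times [a k], this reads [delta k ^+ 2 - rho ^+ 2 < 2 * a k * lam], so the exponent is
   negative. *)
have : 1 + - (2 * lam) < expR (- (2 * lam)).
  by rewrite expR_gt1Dx // oppr_eq0 mulf_neq0 ?pnatr_eq0 // gt_eqF.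
rewrite -(ltr_pM2l (a_gt0 k)).
have -> : a k * expR (- (2 * lam)) = rho ^+ 2.
  rewrite /a deltaE exprMn -expRM_natl mulrAC -expRD.
  by rewrite subrr expR0 mul1r.
rewrite /a; lra.
Qed.

Theorem theorem1p3 (K : realType) (d N : nat) (P : 'I_N -> cpoly K d)
  (delta : 'I_N -> K) (R : K)
  (P_neq0 : forall j : 'I_N, P j != 0)
  (delta_gt0 : forall j : 'I_N, 0 < delta j)
  (R_gt0 : 0 < R)
  (sum_le : \sum_(j < N) delta j ^+ 2 * (tdeg (P j))%:R <= R ^+ 2)
  (z : 'rV[complex K]_d)
  (z_max : max_point_on (weight P delta) (l2cball R) z)
  (k : 'I_N) :
  ((delta k)%:E <= dist_to_set z (zero_set (P k)))%E.
Proof.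
have z_global y := weight_max_global y delta_gt0 R_gt0 sum_le z_max.
have [y y_gt0] := exists_weight_gt0 delta P_neq0.
apply: le_ereal_inf_tmp => _ [w Pkw <-]; rewrite lee_fin.
have z_gt0 := lt_le_trans y_gt0 (z_global y).
exact: (weight_global_max_dist delta_gt0 z_gt0 z_global Pkw).
Qed.
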